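(* Let $p$ be a prime and let $G_1$ be a finite $p$-group which is neither cyclic nor generalized quaternion. Then $\gamma(\mathcal{G}_E^{**}(G_1))$ equals the number of distinct subgroups of order $p$ of $G_1$. Moreover, if $G=G_1\times\mathbb{Z}_n$, where $n$ is a positive integer with $\gcd(p,n)=1$, then $\gamma(\mathcal{G}_E^{**}(G))$ also equals the number of distinct subgroups of order $p$ of $G_1$.
   Context: For a group $G$, the enhanced power graph $\mathcal{G}_E(G)$ is the simple graph with vertex set $G$ in which two distinct elements $x,y$ are adjacent if and only if there is $w\in G$ with $x,y\in\langle w\rangle$. A dominating vertex of a graph is a vertex adjacent to every other vertex. The proper enhanced power graph $\mathcal{G}_E^{**}(G)$ is the induced subgraph of $\mathcal{G}_E(G)$ obtained by deleting all dominating vertices of $\mathcal{G}_E(G)$. A set $S$ of vertices of a graph $\Gamma$ with vertex set $V$ is dominating if every vertex of $V\setminus S$ is adjacent to some vertex of $S$; the domination number $\gamma(\Gamma)$ is the minimum cardinality of a dominating set. A $p$-group is a group of order $p^r$ with $r\ge 1$. $\mathbb{Z}_n$ is the cyclic group of order $n$. *)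

(* Defs.v *)
From mathcomp Require Import all_boot all_fingroup all_solvable.
From mathcomp Require Import all_algebra.
Set Implicit Arguments.
Unset Strict Implicit.
Unset Printing Implicit Defensive.

Local Open Scope group_scope.

(* A finite simple graph is given by a vertex set V : {set T} and an adjacency *)
(* relation e : rel T, of which only the restriction to V matters; the induced *)
(* subgraph on W \subset V is then the pair (W, e).                            *)

Section DominationNumber.

Variables (T : finType) (e : rel T) (V : {set T}).

Definition dominating_vertex (v : T) : bool :=
  (v \in V) && [forall u in V, (u != v) ==> e v u].

Definition dominating_set (S : {set T}) : bool :=
  (S \subset V) && [forall v in V :\: S, exists u in S, e v u].

(* V is itself a dominating set, so the minimum is taken over a nonempty       *)
(* family.                                                                     *)
Definition domination_number : nat :=
  #|[arg min_(S < V | dominating_set S) #|S| ]|.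

End DominationNumber.

Section EnhancedPowerGraph.

Variables (gT : finGroupType) (G : {group gT}).

Definition epg_adj : rel gT :=
  fun x y => (x != y) && [exists w in G, (x \in <[w]>) && (y \in <[w]>)].

Definition proper_epg_vertices : {set gT} :=
  [set x in G | ~~ dominating_vertex epg_adj G x].

Definition proper_epg_domination_number : nat :=
  domination_number epg_adj proper_epg_vertices.

Definition generalized_quaternion : Prop :=
  exists2 m : nat, 2 < m & G \isog 'Q_(2 ^ m).

Definition subgroups_of_order (p : nat) : {set {group gT}} :=
  [set H in subgroups G | #|H| == p].

End EnhancedPowerGraph.

(* Main.v *)
Require Import Defs.
From mathcomp Require Import all_boot all_fingroup all_solvable.
From mathcomp Require Import all_algebra.

Local Open Scope group_scope.

(** A cyclic group has exactly one subgroup of each order dividing its own, so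
    adjacency in the enhanced power graph cannot change the subgroup of order
    [p]: if [x] and [y] lie in a common cyclic group and [p] divides both their
    orders, then <[x]> and <[y]> contain the same subgroup of order [p].

    Call an element [p]-singular when [p] divides its order. If the vertices of
    the proper enhanced power graph are exactly the [p]-singular elements, the
    remark above determines the domination number
    ([domination_number_p_singular]). One generator for each subgroup of order
    [p] gives a dominating set, because [x] is equal or adjacent to the
    generator chosen in <[x]>. Conversely, the vertex that dominates a generator
    of [H] must have [H] as its subgroup of order [p]; hence sending a vertex to
    its subgroup of order [p] maps any dominating set onto the set of all these
    subgroups.

    The vertices are indeed the [p]-singular elements when the group is the
    direct product of a [p]-group and a cyclic [p']-group, and has at least two
    subgroups of order [p] ([proper_epg_vertices_dprod]). A [p]-singular element
    cannot dominate generators of two different subgroups of order [p]. Any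
    other element lies in the cyclic factor <[c]>, so it shares with an
    arbitrary [a * b] the cyclic group <[a * c]> = <[a]> * <[c]>.

    Finally, a nontrivial [p]-group with at most one subgroup of order [p] is
    cyclic or generalized quaternion ([many_subgroups_of_order]): that subgroup
    is then 'Ohm_1, and the classification [prime_Ohm1P] applies. The two parts
    of the theorem are the cases of a trivial and of a general cyclic factor. *)

Section SubgroupsOfPrimeOrder.
Variables (gT : finGroupType) (p : nat).
Hypothesis p_pr : prime p.
Implicit Types (G H K P C : {group gT}) (x y : gT).

Lemma subgroups_of_orderP G H :
  reflect (H \subset G /\ #|H| = p) (H \in subgroups_of_order G p).
Proof. by rewrite !inE; apply: (iffP andP) => [] [-> /eqP]. Qed.

(** * Subgroups of order p in cyclic groups *)

(** When [p] divides the order of [x], this is the only subgroup of order [p] of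
    <[x]>; see [eq_order_p_subgroup]. *)
Definition order_p_subgroup x := <[x ^+ (#[x] %/ p)]>%G.

Lemma card_order_p_subgroup x : p %| #[x] -> #|order_p_subgroup x| = p.
Proof.
move=> p_x; rewrite [LHS](orderXdiv (dvdn_div p_x)).
by rewrite divnA // mulKn.
Qed.

Lemma order_p_subgroup_sub x : order_p_subgroup x \subset <[x]>.
Proof. by rewrite cycle_subG mem_cycle. Qed.

(** Inclusion between subgroups of the cyclic group <[w]> is divisibility of
    their orders, so <[x]> contains every subgroup of <[w]> of order [p]. *)
Lemma sub_cycle_in_common_cycle H x w : #|H| = p -> p %| #[x] ->
  H \subset <[w]> -> x \in <[w]> -> H \subset <[x]>.
Proof.
move=> oH p_x sHw xw.
by rewrite -(cardSg_cyclic (cycle_cyclic w)) ?cycle_subG // oH.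
Qed.

Lemma eq_order_p_subgroup H x : #|H| = p -> p %| #[x] ->
  H \subset <[x]> -> H = order_p_subgroup x.
Proof.
move=> oH p_x sHx; apply/val_inj/eqP.
rewrite eqEcard oH card_order_p_subgroup // leqnn andbT /=.
by rewrite -(cardSg_cyclic (cycle_cyclic x)) ?order_p_subgroup_sub // oH
  card_order_p_subgroup.
Qed.

(** [repr H^#] is a canonical choice of a generator of a group [H] of prime
    order. *)
Lemma repr_prime_group H : #|H| = p ->
  [/\ repr H^# \in H, #[repr H^#] = p & H :=: <[repr H^#]>].
Proof.
move=> oH; have ntH : H :!=: 1 by rewrite -cardG_gt1 oH prime_gt1.
have /trivgPn[x Hx ntx] := ntH.
have rH : repr H^# \in H^# by apply: (mem_repr x); rewrite !inE ntx.
have HE : H :=: <[repr H^#]> by apply: nt_gen_prime => //; rewrite oH.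
by split; [case/setD1P: rH | rewrite orderE -HE | ].
Qed.

(** * Domination by elements of order p *)

Lemma epg_adjP G x y :
  reflect (x != y /\ exists w, [/\ w \in G, x \in <[w]> & y \in <[w]>])
          (epg_adj G x y).
Proof.
apply: (iffP andP) => [[-> /exists_inP[w Gw /andP[xw yw]]]|[-> [w [Gw xw yw]]]].
  by split=> //; exists w.
by split=> //; apply/exists_inP; exists w => //; rewrite xw.
Qed.

(** Being equal or adjacent to a generator of [H] forces [x] to lie in a cyclic
    group containing [H]. Both uses, the lower bound and the description of the
    dominating vertices, need this reflexive closure of adjacency. *)
Lemma sub_cycle_of_closed_nbhd G H x : #|H| = p -> p %| #[x] ->
  (x != repr H^# -> epg_adj G x (repr H^#)) -> H \subset <[x]>.
Proof.
move=> oH p_x; have [_ _ HE] := repr_prime_group _ oH.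
case: eqVneq => [-> _ | _ /(_ isT)/epg_adjP[_ [w [_ xw rw]]]].
  by rewrite {1}HE.
by apply: (sub_cycle_in_common_cycle _ _ w) => //; rewrite HE cycle_subG.
Qed.

(** The upper bound comes from the image of [H |-> repr H^#], the lower bound
    from the surjectivity of [order_p_subgroup] on a dominating set. *)
Theorem domination_number_p_singular G :
    proper_epg_vertices G = [set x in G | p %| #[x]] ->
  proper_epg_domination_number G = #|subgroups_of_order G p|.
Proof.
move=> VE; rewrite /proper_epg_domination_number /domination_number VE.
set V := [set x in G | _]; set e := epg_adj G.
have reprV H : H \in subgroups_of_order G p -> repr H^# \in V.
  case/subgroups_of_orderP=> sHG oH; have [Hr or _] := repr_prime_group _ oH.
  by rewrite inE (subsetP sHG) //= or.
case: arg_minnP => [|S /andP[/subsetP sSV domS] minS].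
  by rewrite /dominating_set subxx; apply/forall_inP=> v; rewrite setDv inE.
apply/eqP; rewrite eqn_leq; apply/andP; split.
  (* The chosen generators of the subgroups of order p form a dominating set. *)
  apply: leq_trans (leq_imset_card (fun H : {group gT} => repr H^#) _).
  apply: minS; apply/andP; split.
    by apply/subsetP=> _ /imsetP[H HG ->]; apply: reprV.
  apply/forall_inP=> v /setDP[]; rewrite inE => /andP[Gv p_v] S'v.
  have oH := card_order_p_subgroup _ p_v.
  have HG : order_p_subgroup v \in subgroups_of_order G p.
    apply/subgroups_of_orderP; split=> //.
    by apply: subset_trans (order_p_subgroup_sub v) _; rewrite cycle_subG.
  apply/exists_inP; exists (repr (order_p_subgroup v)^#); first exact: imset_f.
  apply/epg_adjP; split; first by apply: contraNneq S'v => ->; exact: imset_f.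
  have [Hr _ _] := repr_prime_group _ oH.
  exists v; split=> //; first exact: cycle_id.
  exact: (subsetP (order_p_subgroup_sub v)).
(* Every H of order p is the subgroup of order p of some s in S, namely the
   vertex s that dominates the chosen generator of H. *)
apply: leq_trans (leq_imset_card order_p_subgroup S).
apply/subset_leq_card/subsetP=> H HG; have Vr := reprV H HG.
have /subgroups_of_orderP[sHG oH] := HG.
suff [s Ss nbhd_s]: exists2 s, s \in S & s != repr H^# -> e s (repr H^#).
  have := sSV s Ss; rewrite inE => /andP[_ p_s].
  apply/imsetP; exists s => //; apply: eq_order_p_subgroup => //.
  exact: (sub_cycle_of_closed_nbhd G).
have [Sr | S'r] := boolP (repr H^# \in S).
  by exists (repr H^#) => //; rewrite eqxx.
have /exists_inP[s Ss /epg_adjP[_ [w [Gw rw sw]]]]: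
    [exists u in S, e (repr H^#) u].
  by apply: (forall_inP domS); rewrite inE S'r.
by exists s => // ns; apply/epg_adjP; split=> //; exists w.
Qed.

(** * Direct products of a p-group and a cyclic p'-group *)

Section Dprod.
Variables P C G : {group gT}.
Hypotheses (defG : P \x C = G) (pP : p.-group P).
Hypotheses (p'C : p^'.-group C) (cycC : cyclic C).

(** The factor [C] is a normal Hall subgroup, hence contains all [p']-elements. *)
Lemma p'_elt_dprod x : x \in G -> ~~ (p %| #[x]) -> x \in C.
Proof.
move=> Gx p'x; have [_ nCG] := dprod_normal2 defG.
have [_ defPC _ _] := dprodP defG.
have [_ hallC] := coprime_mulpG_Hall defPC pP p'C.
by rewrite (mem_normal_Hall hallC nCG Gx) /p_elt p'natE.
Qed.

Lemma subgroups_of_order_dprod :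
  subgroups_of_order G p = subgroups_of_order P p.
Proof.
have [nPG _] := dprod_normal2 defG.
have [_ defPC _ _] := dprodP defG.
have [hallP _] := coprime_mulpG_Hall defPC pP p'C.
apply/setP=> H; apply/subgroups_of_orderP/subgroups_of_orderP => [] [sH oH].
  split=> //; rewrite (sub_normal_Hall hallP nPG sH).
  by rewrite /pgroup oH pnat_id.
by split=> //; apply: subset_trans sH (normal_sub nPG).
Qed.

(** Two distinct subgroups of order [p] cannot both lie in <[x]>, so no
    [p]-singular [x] is dominating; every other element is, thanks to the cyclic
    factor. *)
Lemma proper_epg_vertices_dprod : 1 < #|subgroups_of_order G p| ->
  proper_epg_vertices G = [set x in G | p %| #[x]].
Proof.
case/card_gt1P=> H [K [HG KG neqHK]].
have [/subgroups_of_orderP[sHG oH] /subgroups_of_orderP[sKG oK]] := (HG, KG).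
apply/setP=> x; rewrite !inE; case Gx: (x \in G) => //=.
rewrite /dominating_vertex Gx /=; apply/idP/idP => [|p_x]; last first.
  apply: contra neqHK => /forall_inP domx.
  have sub_x L : L \in subgroups_of_order G p -> L = order_p_subgroup x.
    case/subgroups_of_orderP=> sLG oL; apply: eq_order_p_subgroup => //.
    have [Lr _ _] := repr_prime_group _ oL.
    apply: (sub_cycle_of_closed_nbhd G) => // nxr.
    by apply: (implyP (domx _ _)); rewrite ?(subsetP sLG) // eq_sym.
  by rewrite (sub_x H) // (sub_x K).
apply: contraR => p'x; have Cx := p'_elt_dprod _ Gx p'x.
apply/forall_inP=> y Gy; apply/implyP=> nyx.
(* With y = a * b, the generator a * c of <[a]> * C reaches both x and y. *)
have /cyclicP[c defC] := cycC.
have [a [b [Pa Cb defy _]]] := mem_dprod defG Gy; rewrite defy in nyx *.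
have Cc : c \in C by rewrite defC cycle_id.
have [_ defPC cPC _] := dprodP defG.
have defw : <[a * c]> = <[a]> * C.
  rewrite defC cycleM //; first exact: (centsP (etrans (centsC _ _) cPC)).
  exact: pnat_coprime (mem_p_elt pP Pa) (mem_p_elt p'C Cc).
have Cw : C \subset <[a * c]> by rewrite defw mulG_subr.
have aw : <[a]> \subset <[a * c]> by rewrite defw mulG_subl.
rewrite cycle_subG in aw.
apply/epg_adjP; split; first by rewrite eq_sym.
exists (a * c); split; first by rewrite -defPC mem_mulg.
  exact: (subsetP Cw).
by rewrite groupM // (subsetP Cw).
Qed.

Theorem domination_number_dprod : 1 < #|subgroups_of_order P p| ->
  proper_epg_domination_number G = #|subgroups_of_order P p|.
Proof.
rewrite -subgroups_of_order_dprod => ?.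
exact/domination_number_p_singular/proper_epg_vertices_dprod.
Qed.
End Dprod.

(** * p-groups with a single subgroup of order p *)

(** If <[x]> were the only subgroup of order [p], it would contain all [y] with
    [y ^+ p = 1], whence 'Ohm_1(G) = <[x]> has order [p]. *)
Lemma many_subgroups_of_order G : p.-group G -> G :!=: 1 ->
    ~~ cyclic G -> ~ generalized_quaternion G ->
  1 < #|subgroups_of_order G p|.
Proof.
move=> pG ntG ncycG nquatG; rewrite ltnNge; apply/negP=> le1.
have [_ p_G _] := pgroup_pdiv pG ntG.
have [x Gx ox] := Cauchy p_pr p_G.
have xG : <[x]>%G \in subgroups_of_order G p.
  by apply/subgroups_of_orderP; rewrite cycle_subG.
suff oOhm : #|'Ohm_1(G)| = p.
  have := introT (prime_Ohm1P pG ntG) oOhm.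
  by rewrite (negPf ncycG) => /andP[_ /eqP/quaternion_classP].
suff -> : 'Ohm_1(G) = <[x]> by [].
apply/eqP; rewrite eqEsubset (OhmE 1 pG) gen_subG cycle_subG; apply/andP; split.
  apply/subsetP=> y; rewrite !inE expn1 => /andP[Gy yp].
  have [-> | nty] := eqVneq y 1; first exact: group1.
  have yG : <[y]>%G \in subgroups_of_order G p.
    apply/subgroups_of_orderP; rewrite cycle_subG; split=> //.
    by apply: nt_prime_order => //; apply/eqP.
  have /(congr1 val)/= -> : <[x]>%G = <[y]>%G by apply: (card_le1_eqP le1).
  exact: cycle_id.
by rewrite mem_gen // !inE Gx expn1 -ox expg_order eqxx.
Qed.
End SubgroupsOfPrimeOrder.

(** * The external direct product *)

Lemma card_subgroups_of_order_injm (aT rT : finGroupType) (D G : {group aT})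
    (f : {morphism D >-> rT}) (p : nat) : 'injm f -> G \subset D ->
  #|subgroups_of_order (f @* G)%G p| = #|subgroups_of_order G p|.
Proof.
move=> injf sGD.
rewrite -(card_in_imset (f := fun H : {group aT} => (f @* H)%G)).
  apply: eq_card => K; apply/subgroups_of_orderP/imsetP => [[sKfG oK] | ].
    have sKfD : K \subset f @* D := subset_trans sKfG (morphimS f sGD).
    exists (f @*^-1 K)%G; last by apply/val_inj; rewrite /= morphpreK.
    apply/subgroups_of_orderP; split.
      by rewrite -(injmK injf sGD) morphpreS.
    by rewrite -(card_injm injf) ?subsetIl ?morphpreK.
  case=> H /subgroups_of_orderP[sHG oH] ->; split; first exact: morphimS.
  by rewrite card_injm // (subset_trans sHG).
move=> H K /subgroups_of_orderP[sHG _] /subgroups_of_orderP[sKG _] [eqfHK].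
by apply/val_inj/(injm_morphim_inj injf) => //; apply: subset_trans sGD.
Qed.

Lemma cyclic_Zp n : cyclic (Zp n).
Proof.
rewrite /Zp; case: ifP => _; last exact: cyclic1.
by rewrite Zp_cycle cycle_cyclic.
Qed.

(* Zp n is the cyclic group of order n for every n > 0, including n = 1        *)
(* (where it is the trivial subgroup of the carrier 'Z_1).                     *)
Theorem theorem2p4 (p : nat) (gT : finGroupType) (G1 : {group gT})
    (p_pr : prime p) (pG1 : p.-group G1) (G1_neq1 : G1 :!=: 1)
    (G1_ncyc : ~~ cyclic G1) (G1_nquat : ~ generalized_quaternion G1) :
  proper_epg_domination_number G1 = #|subgroups_of_order G1 p| /\
  forall n : nat, 0 < n -> coprime p n ->
    proper_epg_domination_number (setX G1 (Zp n))%G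
      = #|subgroups_of_order G1 p|.
Proof.
have many := many_subgroups_of_order _ _ p_pr _ pG1 G1_neq1 G1_ncyc G1_nquat.
split.
  (* Here the cyclic factor is trivial. *)
  apply: (domination_number_dprod _ _ p_pr G1 1%G) => //.
  - exact: dprodg1.
  - exact: pgroup1.
  exact: cyclic1.
move=> n n_gt0 co_pn.
(* Inside the external product the factors are the images of pairg1 and pair1g. *)
have injf := injm_pairg1 gT 'Z_n.
have oP : #|subgroups_of_order (pairg1 'Z_n @* G1)%G p|
        = #|subgroups_of_order G1 p|.
  by apply: card_subgroups_of_order_injm; rewrite ?subsetT.
rewrite -oP; apply: (domination_number_dprod _ _ p_pr _ (@pair1g gT 'Z_n @* Zp n)%G).
- by rewrite /= morphim_pairg1 morphim_pair1g setX_dprod.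
- exact: morphim_pgroup.
- by rewrite morphim_pgroup // /pgroup card_Zp // p'natE // -prime_coprime.
- by rewrite morphim_cyclic ?cyclic_Zp.
by rewrite oP.
Qed.
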